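(* Let $n\ge 0$, let $\pi\in\mathcal A_n$, let $0\le t\le n$, and let $w=\pi_1\cdots\pi_t$. The gap following $w$ in $\pi$ is active if and only if $\mathrm{st}(w)\in\mathcal Q_t$. Moreover, $|\mathcal Q_0|=1$ and $|\mathcal Q_t|=(t-1)!$ for $t\ge1$. Consequently, $$a_{n+1}=\sum_{\pi\in\mathcal A_n}\sum_{t=0}^{n}\mathbf 1\bigl[\mathrm{st}(\pi_1\cdots\pi_t)\in\mathcal Q_t\bigr],$$ where $\mathbf 1[\mathcal E]$ equals $1$ if the statement $\mathcal E$ is true and $0$ otherwise.
   Context: $\mathfrak S_n$ is the set of permutations $\pi=\pi_1\cdots\pi_n$ of $\{1,\dots,n\}$ ($\mathfrak S_0$ consists of the empty permutation). An occurrence of the boxed pattern $\mathrm{Box}(123)$ in $\pi\in\mathfrak S_n$ is a choice of positions $i_1<i_2<i_3$ with $\pi_{i_1}<\pi_{i_2}<\pi_{i_3}$ such that no index $j\ne i_2$ satisfies $i_1<j<i_3$ and $\pi_{i_1}<\pi_j<\pi_{i_3}$. Let $\mathcal A_n$ be the set of permutations in $\mathfrak S_n$ with no occurrence of $\mathrm{Box}(123)$, and $a_n=|\mathcal A_n|$. For a word $w$ with $t$ distinct letters, $\mathrm{st}(w)\in\mathfrak S_t$ is the permutation order-isomorphic to $w$. For $w=w_1\cdots w_t$ with distinct entries set $R_i(w)=|\{j:i<j\le t,\ w_j>w_i\}|$, and let $\mathcal Q_t=\{w\in\mathfrak S_t: R_i(w)\ne1\text{ for all }i\}$. For $\pi\in\mathcal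 A_n$ and $0\le t\le n$, the gap after the first $t$ entries of $\pi$ is called active if the permutation $\pi_1\cdots\pi_t\,(n+1)\,\pi_{t+1}\cdots\pi_n$ obtained by inserting the new maximum in that gap still avoids $\mathrm{Box}(123)$. *)

(* Defs.v *)
From mathcomp Require Import all_boot.

Set Implicit Arguments.
Unset Strict Implicit.
Unset Printing Implicit Defensive.

(* Permutations are kept in one-line notation, as words over the natural
   numbers with the values 1, ..., n; positions are counted from 0.
   [permutations] is duplicate-free (permutations_uniq), so the [size] of a
   filtered sublist is a cardinality. *)
Definition perms (n : nat) : seq (seq nat) := permutations (iota 1 n).

Definition box123_occurrence (w : seq nat) (i1 i2 i3 : 'I_(size w)) : bool :=
  [&& i1 < i2, i2 < i3,
      nth 0 w i1 < nth 0 w i2, nth 0 w i2 < nth 0 w i3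
    & ~~ [exists j : 'I_(size w),
           [&& j != i2, i1 < j, j < i3,
               nth 0 w i1 < nth 0 w j & nth 0 w j < nth 0 w i3]]].

Definition avoids_box123 (w : seq nat) : bool :=
  ~~ [exists i1 : 'I_(size w), exists i2 : 'I_(size w),
      exists i3 : 'I_(size w), box123_occurrence i1 i2 i3].

Definition avoiders (n : nat) : seq (seq nat) :=
  [seq pi <- perms n | avoids_box123 pi].

Definition num_avoiders (n : nat) : nat := size (avoiders n).

(* Each letter is replaced by its rank among the letters of w, the least
   letter getting rank 1; meant for words with distinct letters. *)
Definition st (w : seq nat) : seq nat :=
  [seq count (fun y => y <= x) w | x <- w].

Definition larger_right (w : seq nat) (i : 'I_(size w)) : nat :=
  #|[set j : 'I_(size w) | (i < j) && (nth 0 w i < nth 0 w j)]|.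

Definition Q (t : nat) : seq (seq nat) :=
  [seq w <- perms t | [forall i : 'I_(size w), larger_right i != 1]].

Definition insert_max (n t : nat) (pi : seq nat) : seq nat :=
  take t pi ++ n.+1 :: drop t pi.

Definition active_gap (n : nat) (pi : seq nat) (t : nat) : bool :=
  avoids_box123 (insert_max n t pi).

(* Main.v *)
Require Import Defs.
From mathcomp Require Import all_boot.
From mathcomp Require Import zify.

Set Implicit Arguments.
Unset Strict Implicit.
Unset Printing Implicit Defensive.

(** The maximum N of a permutation can only be the third letter of an
    occurrence of Box(123), and it never lies in the box of an occurrence that
    does not use it.  So inserting N into u ++ v between u and v changes nothing
    for the occurrences without N, and the new occurrences are those whose
    third letter is N: a pair of positions a < b of u such that b is the only
    position of u to the right of a with a larger letter.  Such a pair exists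
    exactly when some letter of u has a single larger letter on its right,
    that is when some R_i(u) equals 1.  This is [avoids_insert_max].  The
    condition on u only compares letters, so it may be read on st(u)
    ([no_lone_larger_map], [st_take_Q]); the gap criterion follows.

    For the size of Q_t, choose the letters from left to right.  If s is the
    set of the remaining letters, the next letter x may be any of them but
    the second largest of s, and the condition on the rest depends on the
    other letters alone.  Hence there are |s| - 1 choices when |s| >= 2 and
    one choice when |s| = 1, which multiply to (t - 1)!
    ([count_no_lone_larger]).

    For the recurrence, each permutation of size n + 1 arises exactly once by
    inserting n + 1 into a permutation of size n ([perms_insert_max]), and by
    the first part the result avoids the pattern if and only if the
    permutation of size n does and the prefix before the gap is, after
    standardization, in Q_t. *)

(** * Occurrences in terms of natural number positions *)

(** Positions are plain numbers here, because inserting a letter changes the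
    type of the ordinals that index a word. *)
Definition box_at (w : seq nat) (a b c : nat) : Prop :=
  [/\ a < b < c, c < size w, nth 0 w a < nth 0 w b < nth 0 w c &
      forall j, a < j < c -> nth 0 w a < nth 0 w j < nth 0 w c -> j = b].

Lemma box123_occurrenceP (w : seq nat) (i1 i2 i3 : 'I_(size w)) :
  reflect (box_at w i1 i2 i3) (box123_occurrence i1 i2 i3).
Proof.
apply: (iffP and5P) => [[lt12 lt23 w12 w23 /existsPn no_j]|].
  split; rewrite ?lt12 ?w12 //.
  move=> j /andP[lt1j ltj3] /andP[w1j wj3].
  have ltj : j < size w by apply: ltn_trans (ltn_ord i3).
  have := no_j (Ordinal ltj); rewrite /= lt1j ltj3 w1j wj3 !andbT negbK.
  by move/eqP => <-.
case=> /andP[lt12 lt23] _ /andP[w12 w23] no_j; split=> //.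
apply/existsPn => j; apply/negP => /and5P[/eqP neq lt1j ltj3 w1j wj3].
by case: neq; apply/val_inj/no_j; rewrite ?lt1j ?w1j.
Qed.

Lemma box123P (w : seq nat) :
  reflect (exists a b c, box_at w a b c) (~~ avoids_box123 w).
Proof.
rewrite negbK; apply: (iffP existsP) => [[i1 /existsP[i2 /existsP[i3]]]|].
  by move/box123_occurrenceP; exists i1, i2, i3.
case=> a [b [c box]]; have [/andP[ltab ltbc] ltc _ _] := box.
have ltb := ltn_trans ltbc ltc; have lta := ltn_trans ltab ltb.
exists (Ordinal lta); apply/existsP; exists (Ordinal ltb).
by apply/existsP; exists (Ordinal ltc); apply/box123_occurrenceP.
Qed.

Definition lone_larger_at (w : seq nat) (a b : nat) : Prop :=
  [/\ a < b < size w, nth 0 w a < nth 0 w b &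
      forall j, a < j < size w -> nth 0 w a < nth 0 w j -> j = b].

Lemma lone_largerP (w : seq nat) :
  reflect (exists a b, lone_larger_at w a b)
          (~~ [forall i : 'I_(size w), larger_right i != 1]).
Proof.
rewrite negb_forall; apply: (iffP existsP) => [[i]|[a [b]]].
  rewrite negbK => /cards1P[b larger_b].
  have := set11 b; rewrite -larger_b inE => /andP[ltib wib].
  exists i, b; split; rewrite ?ltib ?ltn_ord // => j /andP[ltij ltj] wij.
  have: Ordinal ltj \in [set b] by rewrite -larger_b inE /= ltij.
  by rewrite inE => /eqP <-.
case=> /andP[ltab ltb] wab only_b; have lta := ltn_trans ltab ltb.
exists (Ordinal lta); rewrite negbK; apply/cards1P; exists (Ordinal ltb).
apply/setP => j; rewrite !inE /=; apply/andP/eqP => [[ltaj waj]|-> //].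
by apply/val_inj/only_b; rewrite ?ltaj ?ltn_ord.
Qed.

(** * Inserting the maximum *)

Section InsertMaximum.

Variables (u v : seq nat) (N : nat).
Hypothesis ltN : all (gtn N) (u ++ v).

Let h := size u.
Let w := u ++ v.
Let wN := u ++ N :: v.

Lemma nth_insert_max : nth 0 wN h = N.
Proof. by rewrite nth_cat ltnn subnn. Qed.

(** [bump h] renumbers the positions of the word when one is added at h. *)
Lemma nth_insert_bump j : nth 0 wN (bump h j) = nth 0 w j.
Proof.
rewrite !nth_cat /bump; case: (leqP h j) => [lehj | ltjh].
  by rewrite add1n ltnNge leqW //= subSn.
by rewrite add0n ltjh.
Qed.

Lemma size_insert : size wN = (size w).+1.
Proof. by rewrite !size_cat addnS. Qed.

Lemma nth_lt_max j : j < size w -> nth 0 w j < N.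
Proof. by move=> ltj; apply: (allP ltN); apply: mem_nth. Qed.

Lemma nth_le_max j : nth 0 wN j <= N.
Proof.
case: (ltnP j (size wN)) => [/(mem_nth 0)|lej]; last by rewrite nth_default.
rewrite mem_cat inE orbCA => /orP[/eqP-> // | in_w]; apply: ltnW.
by apply: (allP ltN); rewrite mem_cat.
Qed.

(** The position h of N is the only one missed by [bump h], and N is too large
    to lie in a box with top letter below N. *)
Lemma box_at_bump a b c :
  box_at wN (bump h a) (bump h b) (bump h c) <-> box_at w a b c.
Proof.
rewrite /box_at !nth_insert_bump size_insert.
have size_h : h <= size w by rewrite size_cat leq_addr.
split=> -[lt_abc ltc wabc only_b].
  split=> //; try (rewrite /bump in lt_abc ltc; lia).
  move=> j ltajc wajc; apply: (can_inj (bumpK h)); apply: only_b.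
    by rewrite /bump; lia.
  by rewrite nth_insert_bump.
split=> //; try (rewrite /bump; lia).
move=> j ltajc; have [-> | neqj] := eqVneq j h.
  have := nth_lt_max ltc; rewrite nth_insert_max; lia.
have <- : bump h (unbump h j) = j by apply: unbumpK.
rewrite nth_insert_bump => wajc; congr bump; apply: only_b => //.
by move: ltajc neqj; rewrite /bump /unbump; lia.
Qed.

(** As N is above all letters, the box with top right corner at N is bounded
    only from below, so the uniqueness of its inner point is a statement about
    u alone. *)
Lemma box_at_max a b : box_at wN a b h <-> lone_larger_at u a b.
Proof.
rewrite /box_at /lone_larger_at nth_insert_max.
have nth_u j : j < h -> nth 0 wN j = nth 0 u j by rewrite nth_cat => ->.
have nth_uN j : j < h -> nth 0 u j < N.
  by move=> ltj; apply: (allP ltN); rewrite mem_cat mem_nth.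
split=> [[/andP[ltab ltb] _ + only_b] | [/andP[ltab ltb] uab only_b]];
  have lta := ltn_trans ltab ltb.
  rewrite !nth_u // => /andP[uab _].
  split; rewrite ?ltab // => j /andP[ltaj ltj] uaj.
  by apply: only_b; rewrite ?ltaj // !nth_u // uaj nth_uN.
split=> [|||j]; rewrite ?ltab ?size_insert ?ltnS ?size_cat ?leq_addr //.
  by rewrite !nth_u // uab nth_uN.
move=> /andP[ltaj ltj]; rewrite !nth_u // => /andP[uaj _].
by apply: only_b; rewrite ?ltaj.
Qed.

(** N is not below another letter, so an occurrence has N as third letter or
    does not use N. *)
Lemma avoids_insert_max :
  avoids_box123 wN =
  avoids_box123 w && [forall i : 'I_(size u), larger_right i != 1].
Proof.
apply: negb_inj; rewrite negb_and.
apply/box123P/orP => [[a [b [c box]]] | [/box123P | /lone_largerP]].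
- have [/andP[ltab ltbc] _ /andP[wab wbc] _] := box.
  have /= lebN := nth_le_max b; have lecN := nth_le_max c.
  have neqa : h != a.
    by apply/eqP => eqa; move: wab; rewrite -eqa nth_insert_max; lia.
  have neqb : h != b.
    by apply/eqP => eqb; move: wbc; rewrite -eqb nth_insert_max; lia.
  have [eqc | neqc] := eqVneq c h.
    by right; apply/lone_largerP; exists a, b; apply/box_at_max; rewrite -eqc.
  left; apply/box123P; exists (unbump h a), (unbump h b), (unbump h c).
  by apply/box_at_bump; rewrite !unbumpK // inE 1?eq_sym.
- case=> a [b [c /box_at_bump box]].
  by exists (bump h a), (bump h b), (bump h c).
- by case=> a [b /box_at_max box]; exists a, b, h.
Qed.

End InsertMaximum.

(** * The condition R_i <> 1 *)

(** The same condition as in [Q], by recursion on the word: this form is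
    transported by monotone maps and fits the choice of a permutation letter
    by letter. *)
Fixpoint no_lone_larger (w : seq nat) : bool :=
  if w is x :: w' then (count (ltn x) w' != 1) && no_lone_larger w' else true.

Lemma larger_right_sum (w : seq nat) (i : 'I_(size w)) :
  larger_right i = \sum_(j < size w) ((i < j) && (nth 0 w i < nth 0 w j)).
Proof. by rewrite /larger_right cardsE -sum1_card big_mkcond. Qed.

Lemma forall_larger_right (w : seq nat) :
  [forall i : 'I_(size w), larger_right i != 1] = no_lone_larger w.
Proof.
elim: w => [|x w IHw] /=; first by apply/forallP => -[].
have head : @larger_right (x :: w) ord0 = count (ltn x) w.
  rewrite larger_right_sum /= big_ord_recl add0n.
  rewrite -sum1_count [RHS]big_mkcond (big_nth 0) big_mkord.
  by apply: eq_bigr => j _ /=; case: ltnP.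
have tail (i : 'I_(size w)) :
    @larger_right (x :: w) (lift ord0 i) = larger_right i.
  by rewrite !larger_right_sum /= big_ord_recl add0n; apply: eq_bigr.
rewrite -IHw -head; apply/forallP/andP => [all_i | [h0 /forallP all_i] i].
  by split; [exact: all_i | apply/forallP => i; rewrite -tail].
by case: (unliftP ord0 i) => [j ->|-> //]; rewrite tail.
Qed.

Lemma no_lone_larger_map (f : nat -> nat) (w : seq nat) :
  {in w &, {mono f : x y / x < y}} ->
  no_lone_larger (map f w) = no_lone_larger w.
Proof.
elim: w => //= x w IHw f_mono; rewrite count_map IHw; last first.
  by apply: sub_in2 f_mono => y yw; rewrite inE yw orbT.
congr ((_ != 1) && _); apply: eq_in_count => y yw /=.
by rewrite f_mono ?mem_head // inE yw orbT.
Qed.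

Lemma rank_mono (w : seq nat) :
  {in w &, {mono (fun x => count (fun y => y <= x) w) : x y / x < y}}.
Proof.
have le_rank x y : x <= y ->
    count (fun z => z <= x) w <= count (fun z => z <= y) w.
  by move=> lexy; apply: sub_count => z /= /leq_trans; apply.
move=> x y xw yw; case: (ltnP x y) => [ltxy | /le_rank]; last first.
  by rewrite ltnNge => ->.
(* Passing from x to y, the rank gains at least the letter y itself. *)
have disjoint : count (predI (fun z => z <= x) (pred1 y)) w = 0.
  rewrite -(count_pred0 w); apply: eq_count => z /=.
  by apply/negP => /andP[lezx /eqP eqz]; move: lezx; rewrite eqz leqNgt ltxy.
have y_counted : 0 < count (pred1 y) w by rewrite -has_count has_pred1.
have le_y : count (predU (fun z => z <= x) (pred1 y)) w <=
            count (fun z => z <= y) w.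
  apply: sub_count => z /= /orP[lezx | /eqP-> //].
  exact: leq_trans lezx (ltnW ltxy).
by rewrite (leq_trans _ le_y) // -[X in _ < X]addn0 -disjoint count_predUI
           -[X in X < _]addn0 ltn_add2l.
Qed.

Lemma mem_Q (t : nat) (w : seq nat) :
  (w \in Q t) = no_lone_larger w && perm_eq w (iota 1 t).
Proof. by rewrite mem_filter forall_larger_right mem_permutations. Qed.

(** The ranks are distinct by [rank_mono] and lie between 1 and the length. *)
Lemma perm_st_iota (w : seq nat) : uniq w -> perm_eq (st w) (iota 1 (size w)).
Proof.
move=> uniq_w; have uniq_st : uniq (st w).
  rewrite map_inj_in_uniq // => x y xw yw eq_rank.
  have := rank_mono xw yw; have := rank_mono yw xw.
  rewrite eq_rank ltnn; lia.
have st_iota : {subset st w <= iota 1 (size w)}.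
  move=> _ /mapP[x xw ->]; rewrite mem_iota add1n ltnS count_size andbT.
  by rewrite -has_count; apply/hasP; exists x.
have [//|_ mem_st] := uniq_min_size uniq_st st_iota.
  by rewrite size_iota size_map.
by apply: uniq_perm; rewrite ?iota_uniq.
Qed.

Lemma st_take_Q (n t : nat) (pi : seq nat) :
  pi \in perms n -> t <= n ->
  (st (take t pi) \in Q t) = no_lone_larger (take t pi).
Proof.
rewrite mem_permutations => perm_pi le_tn; rewrite mem_Q.
rewrite no_lone_larger_map; last exact: rank_mono.
have size_t : size (take t pi) = t.
  by rewrite size_takel // (perm_size perm_pi) size_iota.
rewrite -{3}size_t perm_st_iota ?andbT // take_uniq //.
by rewrite (perm_uniq perm_pi) iota_uniq.
Qed.

Lemma avoids_insert (n t : nat) (pi : seq nat) :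
  pi \in perms n -> t <= n ->
  avoids_box123 (insert_max n t pi) =
  avoids_box123 pi && (st (take t pi) \in Q t).
Proof.
move=> pi_perm le_tn; rewrite (st_take_Q pi_perm le_tn).
rewrite avoids_insert_max cat_take_drop ?forall_larger_right //.
apply/allP => x; move: pi_perm; rewrite mem_permutations => /perm_mem->.
by rewrite mem_iota add1n => /andP[].
Qed.

(** * The size of Q_t *)

(** Once s is sorted decreasingly as a :: b :: l, the number of letters of s
    above x is 0 for a, 1 for b and at least 2 for the letters of l. *)
Lemma count_not_second_largest (s : seq nat) :
  uniq s -> 1 < size s ->
  count (fun x => count (ltn x) s != 1) s = (size s).-1.
Proof.
move=> uniq_s size_s; have perm_s := permEl (perm_sort geq s).
have sorted_s : sorted gtn (sort geq s).
  rewrite gtn_sorted_uniq_geq sort_uniq uniq_s.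
  by apply: sort_sorted => x y; apply: leq_total.
under eq_count => x do rewrite -(permP perm_s).
rewrite -(permP perm_s) -(perm_size perm_s).
move: sorted_s; rewrite -(perm_size perm_s) in size_s.
case: (sort geq s) size_s => [|a [|b l]] //= _ /andP[ltba].
rewrite (path_sortedE (rev_trans ltn_trans)) => /andP[/allP lt_l _].
have count_l x : b <= x -> count (ltn x) l = 0.
  move=> lebx; apply/eqP; rewrite -leqn0 leqNgt -has_count.
  by apply/hasPn => y /lt_l /=; lia.
have {}lt_l x : x \in l -> x < b by move=> /lt_l.
rewrite (count_l a (ltnW ltba)) (count_l b (leqnn b)) !ltnn ltba.
rewrite ltnNge (ltnW ltba) /= add0n add1n.
congr _.+1; apply/eqP; rewrite -all_count; apply/allP => x /lt_l ltxb /=.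
by rewrite ltxb (ltn_trans ltxb ltba).
Qed.

(** Stated for an arbitrary set of letters s, because the induction removes
    the first letter x, which leaves gaps in an interval of integers.  The
    number of letters above x after it is the number of letters of s above x,
    so the condition on x does not involve the rest of the permutation. *)
Lemma count_no_lone_larger (s : seq nat) :
  uniq s -> 0 < size s ->
  count no_lone_larger (permutations s) = (size s).-1`!.
Proof.
have [n] := ubnP (size s); elim: n s => // n IHn s; rewrite ltnS => le_sn.
move=> uniq_s size_s; have [le_s1 | lt1s] := leqP (size s) 1.
  by case: s size_s le_s1 {le_sn uniq_s} => [|x []].
rewrite (permP (permutationsE size_s)) undup_id // -sum1_count big_mkcond.
rewrite big_allpairs_dep /=.
rewrite (eq_big_seq
           (fun x => (count (ltn x) s != 1) * (size s).-2`!)); last first.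
  move=> x s_x; have perm_x := perm_to_rem s_x.
  rewrite (permP perm_x) /= ltnn add0n -big_mkcond sum1_count.
  have size_x : size (rem x s) = (size s).-1 by rewrite size_rem.
  rewrite -size_x -(IHn _ _ (rem_uniq x uniq_s)); first 1 last.
  - by rewrite size_x; lia.
  - by rewrite size_x; lia.
  case: eqP => [eq1 | neq1].
    rewrite mul0n; apply/eqP; rewrite -leqn0 leqNgt -has_count.
    apply/hasPn => t; rewrite mem_permutations => /permP perm_t /=.
    by rewrite perm_t eq1.
  rewrite mul1n; apply: eq_in_count => t.
  by rewrite mem_permutations /= => /permP->; case: eqP.
rewrite -big_distrl -big_mkcond sum1_count count_not_second_largest //.
by case: (size s) lt1s => [|[|m]] //= _; rewrite factS.
Qed.

(** * The recurrence *)

(** The gap and the smaller permutation are recovered from the result as the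
    index of n + 1 and the word without n + 1. *)
Lemma perms_insert_max (n : nat) :
  perm_eq (perms n.+1)
          [seq insert_max n t pi | pi <- perms n, t <- iota 0 n.+1].
Proof.
have Nnotin pi : pi \in perms n -> n.+1 \notin pi.
  by rewrite mem_permutations => /perm_mem->; rewrite mem_iota; lia.
have size_perm pi : pi \in perms n -> size pi = n.
  by rewrite mem_permutations => /perm_size->; rewrite size_iota.
have index_max pi t : pi \in perms n -> t < n.+1 ->
    index n.+1 (insert_max n t pi) = t.
  move=> pi_n lt_t; rewrite index_cat ifN ?index_head ?addn0 /=.
    by rewrite size_takel ?size_perm.
  by apply: contra (Nnotin _ pi_n); apply: mem_take.
have rem_max pi t : pi \in perms n -> t < n.+1 ->
    rem n.+1 (insert_max n t pi) = pi.
  move=> pi_n lt_t; rewrite remE index_max // /insert_max.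
  have size_t : size (take t pi) = t by rewrite size_takel ?size_perm.
  rewrite take_size_cat // -cat_rcons drop_size_cat ?cat_take_drop //.
  by rewrite size_rcons size_t.
have iota_max : perm_eq (iota 1 n.+1) (n.+1 :: iota 1 n).
  by rewrite -(addn1 n) iotaD addn1 add1n perm_catC.
apply: uniq_perm; first exact: permutations_uniq.
  apply: allpairs_uniq; rewrite ?permutations_uniq ?iota_uniq //.
  move=> p p' /allpairsP[[pi t] [pi_n t_n ->{p}]].
  move=> /allpairsP[[pi' t'] [pi'_n t'_n ->{p'}]] /= eq_ins.
  rewrite !mem_iota /= in pi_n t_n pi'_n t'_n.
  have := rem_max _ _ pi_n t_n; have := index_max _ _ pi_n t_n.
  by rewrite eq_ins rem_max ?index_max // => -> ->.
move=> s; rewrite mem_permutations (permPr iota_max).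
apply/idP/allpairsP => [perm_s | [[pi t] [/= pi_n _ ->]]]; last first.
  rewrite mem_permutations in pi_n.
  apply: perm_trans (permEl (perm_catCA _ [:: n.+1] _)) _.
  by rewrite /= cat_take_drop perm_cons.
have s_max : n.+1 \in s by rewrite (perm_mem perm_s) mem_head.
exists (rem n.+1 s, index n.+1 s); split; rewrite ?mem_iota /=.
- rewrite mem_permutations -(perm_cons n.+1).
  by rewrite -(permPl (perm_to_rem s_max)).
- by have := s_max; rewrite -index_mem (perm_size perm_s) /= size_iota.
rewrite /insert_max remE.
rewrite take_size_cat ?drop_size_cat ?size_takel ?index_size //.
by rewrite -[LHS](cat_take_drop (index n.+1 s)) drop_index.
Qed.

Theorem theorem6p1 :
  (forall (n : nat) (pi : seq nat) (t : nat),
     pi \in avoiders n -> t <= n ->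
     (active_gap n pi t <-> st (take t pi) \in Q t)) /\
  size (Q 0) = 1 /\
  (forall t : nat, 1 <= t -> size (Q t) = (t - 1)`!) /\
  (forall n : nat,
     num_avoiders n.+1 =
     \sum_(pi <- avoiders n) \sum_(0 <= t < n.+1)
        nat_of_bool (st (take t pi) \in Q t)).
Proof.
split.
  move=> n pi t; rewrite mem_filter => /andP[avoid pi_n] le_tn.
  by rewrite /active_gap avoids_insert // avoid.
split.
  by rewrite size_filter (eq_count forall_larger_right).
split.
  move=> t t_gt0; rewrite size_filter (eq_count forall_larger_right).
  by rewrite count_no_lone_larger ?iota_uniq ?size_iota ?subn1.
move=> n; rewrite /num_avoiders size_filter (permP (perms_insert_max n)).
rewrite /avoiders big_filter -sum1_count big_mkcond big_allpairs_dep.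
rewrite [RHS]big_mkcond !big_seq; apply: eq_bigr => pi pi_n.
rewrite -[iota 0 _]/(index_iota 0 n.+1).
have [avoid | contains] := boolP (avoids_box123 pi).
  apply: eq_big_nat => t /andP[_ lt_t].
  by rewrite avoids_insert // avoid; case: (_ \in _).
rewrite big_nat big1 // => t /andP[_ lt_t].
by rewrite avoids_insert // (negPf contains).
Qed.
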